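(* Let $p$ be a prime power, let $G$ be a cyclic group of order $p-1$, and let $W$ be a balanced generalized weighing matrix $BGW(p+1,p,p-1)$ over $G$. Then for every positive integer $m$ there exists a balanced generalized weighing matrix $$BGW\left(\frac{p^{m+1}-1}{p-1},\; p^m,\; p^{m-1}(p-1)\right)$$ over $G$.
   Context: Let $G$ be a finite multiplicatively written group. A balanced generalized weighing matrix over $G$ with parameters $(v,k,\lambda)$, denoted $BGW(v,k,\lambda)$ over $G$ or $BGW(v,k,\lambda;G)$, is a $v\times v$ matrix $W=[w_{ij}]$ with entries in $G\cup\{0\}$ (where $0\notin G$ is a formal zero symbol) such that each row of $W$ contains exactly $k$ nonzero entries and, for any distinct $i,j\in\{1,\dots,v\}$, the multiset $\{w_{i\ell}w_{j\ell}^{-1} \mid 1\le \ell\le v,\ w_{i\ell}\ne 0\ne w_{j\ell}\}$ contains exactly $\lambda/|G|$ copies of every element of $G$. *)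

(* Defs.v *)
From mathcomp Require Import all_boot all_order all_fingroup all_algebra all_solvable.

Set Implicit Arguments.
Unset Strict Implicit.
Unset Printing Implicit Defensive.

Local Open Scope group_scope.

Definition prime_power (q : nat) : Prop :=
  exists r n : nat, [/\ prime r, (0 < n)%N & q = (r ^ n)%N].

(* G u {0} is encoded in [option gT]: [None] is the formal zero and [Some x],
   with x in G, the element x. *)
Definition gquot (gT : finGroupType) (a b : option gT) : option gT :=
  if a is Some x then if b is Some y then Some (x * y^-1) else None else None.

(* The last clause says that g occurs exactly lambda / #|G| times in the
   multiset of quotients, the division being exact (so #|G| divides lambda as
   soon as v >= 2). *)
Definition is_BGW (gT : finGroupType) (G : {group gT}) (v k lambda : nat)
    (W : 'M[option gT]_v) : Prop :=
  [/\ forall (i j : 'I_v) (x : gT), W i j = Some x -> x \in G,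
      forall i : 'I_v, #|[set j | W i j != None]| = k
    & forall i j : 'I_v, i != j -> forall g : gT, g \in G ->
        (#|[set l | gquot (W i l) (W j l) == Some g]| * #|G|)%N = lambda].

(* Main.v *)
Require Import Defs.
From mathcomp Require Import all_boot all_order all_fingroup all_algebra all_solvable.
From mathcomp Require Import finfield.

(** Let F be the field with p elements. The points of the projective space of
    dimension m over F, represented by the vectors of F^(m+1) whose first
    nonzero coordinate is 1, index the rows and columns of the matrix of dot
    products of representatives; the nonzero entries are carried into G by an
    isomorphism F^* -> G. For independent u and u', the map
    v |-> (u . v, u' . v) is onto F^2 with fibres of size p^(m-1), and the
    condition u . v = c (u' . v) <> 0 is invariant under scaling of v, so it
    holds at p^(m-1) points. *)

Set Implicit Arguments.
Unset Strict Implicit.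
Unset Printing Implicit Defensive.

Import GRing.Theory.
Local Open Scope ring_scope.

(** All fibres of the surjection [v *m A] are translates of its kernel, so they share one size [K];
    the case of the full target gives K |F|^k = |F|^n. The product form avoids the exponent n -
    k. *)
Lemma card_preim_mulmx (F : finFieldType) (n k : nat) (A : 'M[F]_(n, k))
    (T : {set 'rV[F]_k}) :
  row_full A ->
  (#|[set v : 'rV_n | v *m A \in T]| * #|F| ^ k = #|T| * #|F| ^ n)%N.
Proof.
move=> fullA; set K := #|[set v : 'rV_n | v *m A == 0]|.
have fibre (w : 'rV_k) : #|[set v : 'rV_n | v *m A == w]| = K.
  have [v0 v0A] : exists v0, v0 *m A = w.
    by have /submxP[v0 ->] := submx_full w fullA; exists v0.
  rewrite /K -[RHS](card_imset _ (@addrI _ v0)).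
  congr #|pred_of_set _|; apply/setP => v; rewrite inE; apply/eqP/imsetP.
    move=> vA; exists (v - v0); last by rewrite addrC subrK.
    by rewrite inE mulmxBl vA v0A subrr.
  by case=> x; rewrite inE => /eqP xA ->; rewrite mulmxDl xA addr0.
have count (U : {set 'rV[F]_k}) : #|[set v : 'rV_n | v *m A \in U]| = (#|U| * K)%N.
  rewrite -sum1_card (partition_big (fun v => v *m A) (mem U)) /=; last first.
    by move=> v; rewrite inE.
  rewrite -sum_nat_const; apply: eq_bigr => w Uw.
  rewrite -(fibre w) -sum1_card; apply: eq_bigl => v; rewrite !inE.
  by apply: andb_idl => /eqP ->.
have := count setT; rewrite cardsT card_mx mul1n.
have -> : [set v : 'rV[F]_n | v *m A \in setT] = setT.
  by apply/setP => v; rewrite !inE.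
by rewrite cardsT card_mx mul1n count => ->; rewrite -mulnA (mulnC K).
Qed.

Lemma card_finField_pred_gt0 (F : finFieldType) : (0 < #|F|.-1)%N.
Proof. by rewrite -subn1 subn_gt0 finNzRing_gt1. Qed.

Lemma card_finField_gt0 (F : finFieldType) : (0 < #|F|)%N.
Proof. exact: ltnW (finNzRing_gt1 F). Qed.

Section Projective.
Variables (F : finFieldType) (n : nat).
Implicit Types (u v w : 'rV[F]_n) (c : F).

(** On ordinals [pick] returns the first index that qualifies. Proportional nonzero vectors share
    that index, and the default 0 is reached only by the zero vector. *)
Definition lead_entry v : F :=
  if [pick i | v 0 i != 0] is Some i then v 0 i else 0.

Lemma lead_entryZ c v : c != 0 -> lead_entry (c *: v) = c * lead_entry v.
Proof.
move=> c0; rewrite /lead_entry (@eq_pick _ _ (fun i => v 0 i != 0)).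
  by case: pickP => [i _|_]; rewrite ?mxE ?mulr0.
by move=> i; rewrite mxE mulf_eq0 negb_or c0.
Qed.

Lemma lead_entry_neq0 v : (lead_entry v != 0) = (v != 0).
Proof.
rewrite /lead_entry; case: pickP => [i vi|v0].
  by rewrite vi; apply/esym; apply: contraNneq vi => ->; rewrite mxE.
rewrite eqxx; apply/esym/negbTE; rewrite negbK; apply/eqP/rowP => i.
by rewrite mxE; apply/eqP; have := v0 i; case: eqP.
Qed.

Definition proj_points : {set 'rV[F]_n} := [set v | lead_entry v == 1].

Lemma proj_pointsP v : reflect (lead_entry v = 1) (v \in proj_points).
Proof. by rewrite inE; apply: eqP. Qed.

Lemma proj_points_neq0 v : v \in proj_points -> v != 0.
Proof. by move=> /proj_pointsP v1; rewrite -lead_entry_neq0 v1 oner_neq0. Qed.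

(** Comparing leading entries forces c = 1, so each line through the origin has at most one
    representative. *)
Lemma proj_points_scale c u v :
  u \in proj_points -> v \in proj_points -> u = c *: v -> u = v.
Proof.
move=> Pu /proj_pointsP v1 uv.
have c0 : c != 0.
  by apply: contraNneq (proj_points_neq0 Pu) => c0; rewrite uv c0 scale0r.
move/proj_pointsP: Pu; rewrite {1}uv lead_entryZ // v1 mulr1 => c1.
by rewrite uv c1 scale1r.
Qed.

(** Factoring out the leading entry writes each vector of [S] uniquely as a nonzero scalar times a
    representative in [S]. This turns counts of vectors into counts of points. *)
Lemma card_homogeneous (S : {set 'rV[F]_n}) :
  0 \notin S -> (forall c v, c != 0 -> v \in S -> c *: v \in S) ->
  #|S| = (#|F|.-1 * #|S :&: proj_points|)%N.
Proof.
move=> S0 SZ; rewrite -(cardsC1 (0 : F)) -cardsX.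
have injZ : {in setX [set~ (0 : F)] (S :&: proj_points) &,
    injective (fun cw : F * 'rV[F]_n => cw.1 *: cw.2)}.
  move=> [c v] [d w] /setXP[/=]; rewrite !inE => c0 /andP[_ /eqP v1].
  move=> /andP[d0 /andP[_ /eqP w1]] eqcd.
  have cd : c = d.
    by have := congr1 lead_entry eqcd; rewrite !lead_entryZ // v1 w1 !mulr1.
  by rewrite cd in eqcd *; rewrite (scalerI d0 eqcd).
rewrite -(card_in_imset injZ); congr #|pred_of_set _|; apply/setP => v.
apply/idP/imsetP => [Sv|[[c w] /setXP[/=]]]; last first.
  by rewrite !inE => c0 /andP[Sw _] ->; apply: SZ.
have v0 : lead_entry v != 0.
  by rewrite lead_entry_neq0; apply: contraNneq S0 => <-.
exists (lead_entry v, (lead_entry v)^-1 *: v) => /=; last first.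
  by rewrite scalerA mulfV // scale1r.
by rewrite !inE v0 SZ ?invr_eq0 //= lead_entryZ ?invr_eq0 // mulVf.
Qed.

Lemma card_proj_points : (#|F|.-1 * #|proj_points|)%N = (#|F| ^ n).-1.
Proof.
have -> : (#|F| ^ n).-1 = #|[set~ (0 : 'rV[F]_n)]|.
  by rewrite cardsC1 card_mx mul1n.
rewrite (@card_homogeneous [set~ 0]) ?inE ?eqxx //; last first.
  by move=> c v c0; rewrite !inE scaler_eq0 negb_or c0.
congr (_ * _)%N; congr #|pred_of_set _|; apply/setP => v; rewrite in_setI.
by apply/esym/andb_idl => Pv; rewrite !inE proj_points_neq0.
Qed.

Definition dot u v : F := (u *m v^T) 0 0.

Lemma dotZr u c v : dot u (c *: v) = c * dot u v.
Proof. by rewrite /dot linearZ /= -scalemxAr mxE. Qed.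

Lemma dot0r u : dot u 0 = 0.
Proof. by rewrite -(scale0r 0) dotZr mul0r. Qed.

Lemma dotC u v : dot u v = dot v u.
Proof. by rewrite /dot -(trmxK u) -trmx_mul mxE trmxK. Qed.

End Projective.

(** This is the row weight. The dot product with [u] is onto F with fibres of size |F|^m; its |F| -
    1 nonzero values cancel against the |F| - 1 scalings of each point. *)
Lemma card_points_dot_neq0 (F : finFieldType) (m : nat) (u : 'rV[F]_m.+1) :
  u \in proj_points F m.+1 ->
  #|[set v in proj_points F m.+1 | dot u v != 0]| = (#|F| ^ m)%N.
Proof.
move=> Pu; set S := [set v : 'rV[F]_m.+1 | dot u v != 0].
have -> : [set v in proj_points F m.+1 | dot u v != 0] = S :&: proj_points F m.+1.
  by apply/setP => v; rewrite !inE andbC.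
have full : row_full u^T.
  by rewrite /row_full mxrank_tr rank_rV proj_points_neq0.
have := card_preim_mulmx [set~ 0] full.
have -> : [set v : 'rV[F]_m.+1 | v *m u^T \in [set~ 0]] = S.
  apply/setP => v; rewrite !inE dotC /dot; congr (~~ _).
  apply/eqP/eqP => [->|v0]; first by rewrite mxE.
  by apply/rowP => i; rewrite ord1 [RHS]mxE.
rewrite cardsC1 card_mx (@card_homogeneous _ _ S); first last.
- by move=> c v c0; rewrite !inE dotZr mulf_eq0 negb_or c0.
- by rewrite inE dot0r eqxx.
rewrite muln1 expn1 expnSr !mulnA => /eqP.
rewrite eqn_pmul2r ?card_finField_gt0 // eqn_pmul2l ?card_finField_pred_gt0 //.
by move/eqP.
Qed.

(** In a relation a u + b u' = 0, a nonzero a would make [u] a multiple of [u'], hence equal to it;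
    then b u' = 0 gives b = 0. *)
Lemma row_free_points (F : finFieldType) (n : nat) (u u' : 'rV[F]_n) :
  u \in proj_points F n -> u' \in proj_points F n -> u != u' ->
  row_free (col_mx u u').
Proof.
move=> Pu Pu' neq; apply: inj_row_free => v.
rewrite -[v]hsubmxK mul_row_col [lsubmx v]mx11_scalar [rsubmx v]mx11_scalar.
rewrite !mul_scalar_mx.
move: (lsubmx v 0 0) (rsubmx v 0 0) => a b ab.
have a0 : a = 0.
  apply/eqP; apply: contraNT neq => a0; apply/eqP.
  apply: (@proj_points_scale _ _ (- (a^-1 * b)) _ _ Pu Pu').
  move/eqP: ab; rewrite addr_eq0 => /eqP /(congr1 ( *:%R a^-1)).
  by rewrite scalerN !scalerA mulVf // scale1r scaleNr.
move/eqP: ab; rewrite a0 scale0r add0r scaler_eq0.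
rewrite (negbTE (proj_points_neq0 Pu')) orbF => /eqP ->.
by rewrite !raddf0 row_mx0.
Qed.

Lemma card_points_dot_ratio (F : finFieldType) (m : nat) (u u' : 'rV[F]_m.+2)
    (c : F) :
  u \in proj_points F m.+2 -> u' \in proj_points F m.+2 -> u != u' -> c != 0 ->
  #|[set v in proj_points F m.+2 |
      (dot u' v != 0) && (dot u v == c * dot u' v)]| = (#|F| ^ m)%N.
Proof.
move=> Pu Pu' neq c0.
set Q := fun v : 'rV[F]_m.+2 =>
  (dot u' v != 0) && (dot u v == c * dot u' v).
set S := [set v | Q v].
have -> : [set v in proj_points F m.+2 | Q v] = S :&: proj_points F m.+2.
  by apply/setP => v; rewrite !inE andbC.
(* [L] parametrizes the line of ratio [c] in F^2. [S] is the preimage of its |F| - 1 nonzero points,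
   a factor that again cancels against scaling. *)
pose L (t : F) : 'rV[F]_(1 + 1) := row_mx (c * t)%:M t%:M.
have injL : injective L.
  move=> t t' /eq_row_mx[_ /(congr1 (fun M : 'M_1 => M 0 0))].
  by rewrite !mxE !mulr1n.
have full : row_full (col_mx u u')^T.
  by rewrite /row_full mxrank_tr; apply: row_free_points.
have := card_preim_mulmx [set L t | t in predC1 0] full.
have -> : [set v : 'rV[F]_m.+2 | v *m (col_mx u u')^T \in
    [set L t | t in predC1 0]] = S.
  apply/setP => v; rewrite !inE /Q tr_col_mx mul_mx_row.
  rewrite [v *m u^T]mx11_scalar [v *m u'^T]mx11_scalar.
  rewrite -!/(dot _ _) !(dotC _ v).
  apply/imsetP/andP => [[t t0]|[t0 /eqP ut]]; last first.
    by exists (dot v u'); rewrite ?ut // inE.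
  move=> /eq_row_mx[/(congr1 (fun M : 'M_1 => M 0 0)) + /(congr1 (fun M : 'M_1 => M 0 0))].
  by rewrite !mxE !mulr1n => -> ->; rewrite inE in t0.
rewrite (card_imset _ injL) cardC1 (@card_homogeneous _ _ S); first last.
- move=> a v a0; rewrite !inE /Q !dotZr mulf_eq0 negb_or a0 /= => /andP[-> /eqP ->].
  by rewrite mulrCA eqxx.
- by rewrite inE /Q dot0r eqxx.
have -> : (#|F| ^ m.+2 = #|F| ^ m * #|F| ^ (1 + 1))%N by rewrite -expnD addn2.
rewrite mulnA => /eqP.
rewrite eqn_pmul2r ?expn_gt0 ?card_finField_gt0 //.
by rewrite eqn_pmul2l ?card_finField_pred_gt0 // => /eqP.
Qed.

(** F^* and G are cyclic of the same order, hence isomorphic. The last clause turns an equation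
    between quotients in G into a linear equation over F. *)
Lemma finField_units_to_cyclic (F : finFieldType) (gT : finGroupType)
    (G : {group gT}) :
  cyclic G -> #|G| = #|F|.-1 ->
  exists f : F -> gT,
    [/\ forall x, x != 0 -> f x \in G,
        forall g, g \in G -> exists2 c, c != 0 & f c = g
      & forall x y c, x != 0 -> y != 0 -> c != 0 ->
          ((f x * (f y)^-1)%g == f c) = (x == c * y)].
Proof.
move=> cycG oG.
have : [set: {unit F}] \isog G.
  rewrite isog_cyclic_card ?field_unit_group_cyclic //.
  by rewrite card_finField_unit oG cycG eqxx.
case/isogP => h injh imh.
(* [insubd] sends 0 to the unit 1, which makes [f] total; every clause concerns nonzero
   arguments. *)
pose f (x : F) := h (insubd (1%g : {unit F}) x).
have valU (x : F) : x != 0 -> FinRing.uval (insubd (1%g : {unit F}) x) = x.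
  by move=> x0; rewrite insubdK // unitfE.
exists f; split => [x x0|g|x y c x0 y0 c0].
- by rewrite -imh mem_morphim ?inE.
- rewrite -imh => /morphimP[c _ _ ->]; exists (FinRing.uval c).
    by rewrite -unitfE (valP c).
  by rewrite /f; congr (h _); apply: val_inj; rewrite /= valU // -unitfE (valP c).
rewrite /f; set x' := insubd _ x; set y' := insubd _ y; set c' := insubd _ c.
rewrite -morphV ?inE // -morphM ?inE // (inj_in_eq (injmP injh)) ?inE //.
rewrite -(inj_eq (mulIg y')) mulgKV -val_eqE /=.
by rewrite /x' /y' /c' !valU.
Qed.

Lemma card_enum_val (T : finType) (A : {set T}) (Q : pred T) :
  #|[set i : 'I_#|A| | Q (enum_val i)]| = #|[set x in A | Q x]|.
Proof.
rewrite -(card_imset _ enum_val_inj); congr #|pred_of_set _|; apply/setP => x.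
rewrite inE; apply/imsetP/andP => [[i]|[Ax Qx]].
  by rewrite inE => Qi ->; split=> //; apply: enum_valP.
by exists (enum_rank_in Ax x); rewrite ?inE enum_rankK_in.
Qed.

Theorem projective_BGW (F : finFieldType) (gT : finGroupType) (G : {group gT})
    (m : nat) :
  cyclic G -> #|G| = #|F|.-1 ->
  exists W : 'M[option gT]_#|proj_points F m.+2|,
    is_BGW G (#|F| ^ m.+1) (#|F| ^ m * #|F|.-1) W.
Proof.
move=> cycG oG; have [f [fG fsurj fquot]] := finField_units_to_cyclic cycG oG.
pose e (x : F) := if x == 0 then None else Some (f x).
exists (\matrix_(i, j) e (dot (enum_val i) (enum_val j))); split.
- move=> i j x; rewrite mxE /e; case: eqP => // /eqP d0 [<-]; exact: fG.
- move=> i; rewrite -(@card_points_dot_neq0 _ _ (enum_val i)) ?enum_valP //.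
  rewrite -card_enum_val; apply: eq_card => j; rewrite !inE mxE /e.
  by case: (dot _ _ == 0).
move=> i j neq g /fsurj[c c0 <-].
rewrite oG; congr (_ * _)%N.
rewrite -(@card_points_dot_ratio _ _ (enum_val i) (enum_val j) c) ?enum_valP //;
  last by rewrite (inj_eq enum_val_inj).
rewrite -card_enum_val; apply: eq_card => l; rewrite !inE !mxE /e.
set x := dot (enum_val i) _; set y := dot (enum_val j) _.
(* If a dot product vanishes, the quotient is [None]. On the other side, y = 0 is excluded outright,
   and x = 0 would contradict c * y being nonzero. *)
have [->|y0] := eqVneq y 0; first by case: (x == 0).
have [->|x0] := eqVneq x 0; last by rewrite /= -(fquot x y c).
by apply/esym/negbTE; rewrite eq_sym mulf_neq0.
Qed.

Local Close Scope ring_scope.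
Unset Implicit Arguments.

Theorem theorem7 (p : nat) (gT : finGroupType) (G : {group gT})
    (W : 'M[option gT]_(p + 1)) :
  prime_power p -> cyclic G -> #|G| = p - 1 ->
  is_BGW G p (p - 1) W ->
  forall m : nat, 0 < m ->
  exists W' : 'M[option gT]_((p ^ (m + 1) - 1) %/ (p - 1)),
    is_BGW G (p ^ m) (p ^ (m - 1) * (p - 1)) W'.
Proof.
(* From here the exponent of the statement is [m.+1], so the vectors have length [m.+2]. *)
move=> [r [k [pr_r k0 pE]]] cycG oG _ [//|m] _.
have [F _ cardF] := PrimePowerField pr_r k0.
rewrite -{}pE in cardF.
have Fp : p - 1 = #|F|.-1 by rewrite cardF subn1.
(* The division is exact, since the nonzero vectors number p - 1 times the points. Rewriting the
   matrix size first lets the points index the matrix. *)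
have -> : (p ^ (m.+1 + 1) - 1) %/ (p - 1) = #|proj_points F m.+2|.
  rewrite addn1 subn1 -{1}cardF -card_proj_points Fp mulKn //.
  exact: card_finField_pred_gt0.
rewrite subSS subn0 Fp -cardF; apply: projective_BGW => //.
by rewrite oG Fp.
Qed.
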